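(* Let $C_{132}(0,z)=\sum_{n\ge0}a_n\frac{z^n}{n!}$, where $a_n$ is the number of circular permutations of length $n$ that avoid the consecutive pattern $132$. Then $$C_{132}'(0,z)=e^{C_{132}(0,z)-z^2/2}.$$
   Context: $\mathfrak{S}_n$ denotes the set of permutations $\pi=\pi_1\cdots\pi_n$ of $\{1,\dots,n\}$ in one-line notation ($\mathfrak{S}_0$ consists of the empty permutation). For $\pi\in\mathfrak{S}_n$, $[\pi]$ is the set of all rotations $\pi_i\pi_{i+1}\cdots\pi_n\pi_1\cdots\pi_{i-1}$ of $\pi$, called a circular permutation of length $n$; $[\mathfrak{S}_n]$ is the set of all circular permutations of length $n$ (equivalence classes of $\mathfrak{S}_n$ under rotation), so $[\mathfrak{S}_0]$ has exactly one element, which avoids every pattern, and $a_0=1$. A circular permutation $[\pi]\in[\mathfrak{S}_n]$ avoids the consecutive pattern $132$ if no rotation $\pi'=\pi'_1\cdots\pi'_n\in[\pi]$ has an index $1\le i\le n-2$ with $\pi'_i<\pi'_{i+2}<\pi'_{i+1}$. The series $C_{132}(0,z)$ is the specialization at $u=0$ of $C_{132}(u,z)=\sum_{n\ge0}\sum_{[\pi]\in[\mathfrak{S}_n]}u^{c[\pi]}\frac{z^n}{n!}$, where $c[\pi]$ is the number of occurrences of the consecutive pattern $132$ in $[\pi]$, that is, of subsequences of three cyclically consecutive entries (wrapping around from the end of $\pi$ to the beginning is allowed) that are in the same relative order as $132$. The prime denotes the partial derivative with respect to $z$.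
   Formalization: With a_0 = 1 the displayed identity fails at z = 0 (left side 1, right side e); the formal theorem subtracts the constant term in the exponent and proves C' = e^{C - 1 - z^2/2}. *)

(* Defs.v *)
(* MathComp / MathComp-Analysis *)
From HB Require Import structures.
From mathcomp Require Import all_boot all_order all_fingroup all_algebra.
From mathcomp Require Import all_classical all_reals all_analysis.

Set Implicit Arguments.
Unset Strict Implicit.
Unset Printing Implicit Defensive.

Import Order.TTheory GRing.Theory Num.Theory.
Import numFieldNormedType.Exports.

Local Open Scope ring_scope.

(* A permutation pi_1 ... pi_n of {1, ..., n} is an element s of 'S_n, with
   entries and positions shifted to {0, ..., n - 1}: pi_(i+1) = s i + 1. *)

(* Products in 'S_n are read left to right, so that (shift_perm n ^+ k * s) i
   = s (i + k mod n): the one-line notation of shift_perm n ^+ k * s is that of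
   s rotated k places to the left. *)
Definition shift_perm (n : nat) : 'S_n := perm (@ordS_inj n).

Definition circ (n : nat) (s : 'S_n) : {set 'S_n} :=
  (<[shift_perm n]> :* s)%g.

Definition circ_perms (n : nat) : {set {set 'S_n}} := [set circ s | s : 'S_n].

Definition has132 (n : nat) (s : 'S_n) : bool :=
  [exists i : 'I_n, exists j : 'I_n, exists k : 'I_n,
    [&& j == i.+1 :> nat, k == i.+2 :> nat & (s i < s k < s j)%N]].

Definition avoids132 (n : nat) (c : {set 'S_n}) : bool :=
  [forall s in c, ~~ has132 s].

Definition num_avoid132 (n : nat) : nat :=
  #|[set c in circ_perms n | avoids132 c]|.

(* The power series \sum_n F_n z^n is the function F : nat -> R of its
   coefficients; its derivative in z is pseries_diffs F. *)

Definition fps_monomial (R : realType) (k : nat) : nat -> R :=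
  fun n => (n == k)%:R.

Definition fps_mul (R : realType) (F G : nat -> R) : nat -> R :=
  fun n => \sum_(i < n.+1) F i * G (n - i)%N.

Definition fps_pow (R : realType) (F : nat -> R) (k : nat) : nat -> R :=
  iter k (fps_mul F) (fps_monomial R 0).

(* e^F = \sum_k F^k / k!, the sum being taken coefficientwise.  The constant
   term of F is arbitrary: that of e^F is expR (F 0). *)
Definition fps_exp (R : realType) (F : nat -> R) : nat -> R :=
  fun n => limn (series (fun k => fps_pow F k n / k`!%:R)).

(* C_132(0, z).  Its constant term is 1, because the empty circular permutation
   is counted, whereas its derivative has constant term 1; the exponent in
   C' = e^(C - 1 - z^2/2) must therefore be taken without the constant term of
   C (C' and e^(C - z^2/2) differ by the factor e). *)
Definition C132 (R : realType) : nat -> R :=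
  fun n => (num_avoid132 n)%:R / n`!%:R.

(* Main.v *)
Require Import Defs.
From mathcomp Require Import all_boot all_order all_fingroup all_algebra.
From mathcomp Require Import all_classical all_reals all_analysis.
Import Order.TTheory GRing.Theory Num.Theory.
Import numFieldNormedType.Exports.

Set Implicit Arguments.
Unset Strict Implicit.
Unset Printing Implicit Defensive.

(** Let b_n be the number of arrangements w of n positive letters such that 0w
    avoids the consecutive pattern 132.

    Rotating a circular permutation of length n + 1 so that its minimum comes
    first identifies it with such a 0w, and the windows that wrap around end at
    the minimum or have it in the middle, so they are never occurrences of 132.
    Hence a_(n+1) = b_n ([num_avoid132S]), that is, C' = B := sum b_n z^n/n!.

    Now split w at its minimum m, as w = u m v.  A window that straddles m has m
    in the middle or at the end, so it is not an occurrence, with one exception: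
    if u is a single letter x, the window 0 x m is an occurrence.  Therefore 0w
    avoids 132 iff u is not a single letter and both 0u and mv avoid 132
    ([avoid132_seq_cons_cat_min]).  Summing over the set of letters of u gives
        b_(n+1) = sum_(k != 1) binomial(n, k) b_k b_(n-k)
    ([num_min_first_rec]).  As b_1 = 1, this says B' = (B - z) B.

    Finally B - z is the derivative of E := C - 1 - z^2/2, and e^E is the only
    power series with constant term 1 such that X' = E' X ([fps_exp_unique]);
    hence B = e^E. *)

(** * Avoidance in words *)

Local Open Scope nat_scope.

Fixpoint avoid132_seq (w : seq nat) : bool :=
  if w is a :: w' then
    (if w' is b :: c :: _ then ~~ (a < c < b) else true) && avoid132_seq w'
  else true.

Lemma avoid132_seqP (w : seq nat) :
  reflect (forall i, i.+2 < size w ->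
             ~~ (nth 0 w i < nth 0 w i.+2 < nth 0 w i.+1))
          (avoid132_seq w).
Proof.
apply: (iffP idP).
  elim: w => [|a w IHw] //= /andP[Ha Hw] [|i] lti /=; last exact: IHw.
  by case: w Ha lti {IHw Hw} => [|b [|c w]].
elim: w => [|a w IHw] //= H.
apply/andP; split; last by apply: IHw => i; apply: (H i.+1).
by case: w H {IHw} => [|b [|c w]] // H; apply: (H 0).
Qed.

Lemma avoid132_seq_map (h : nat -> nat) (w : seq nat) :
  {in w &, {mono h : x y / x < y}} ->
  avoid132_seq (map h w) = avoid132_seq w.
Proof.
elim: w => [|a w IHw] //= mono_h.
rewrite IHw => [|x y xw yw]; last by rewrite mono_h // inE ?xw ?yw orbT.
congr (_ && _).
case: w mono_h {IHw} => [|b [|c w]] //= mono_h.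
by rewrite !mono_h // !inE eqxx ?orbT.
Qed.

(** A window that meets both [u] and [m :: v] starts in [u], above [m], and has
    [m] as its second or third letter, whereas an occurrence of 132 starts with
    its smallest letter. *)
Lemma avoid132_seq_cat_min (m : nat) (u v : seq nat) :
  all (ltn m) u ->
  avoid132_seq (u ++ m :: v) = avoid132_seq u && avoid132_seq (m :: v).
Proof.
elim: u => [|x [|y u] IHu] // /andP[ltmx ltmu].
  have lexm: (x < m) = false by rewrite ltnNge ltnW.
  case: v {IHu} => [|c v] //=.
  suff ->: (x < c < m) = false by [].
  by apply/negP => /andP[lt1 lt2]; move: (ltn_trans lt1 lt2); rewrite lexm.
rewrite -andbA -IHu //=.
case: u {IHu ltmu} => [|z u] //=.
by rewrite (ltnNge x m) (ltnW ltmx).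
Qed.

(** The letter [m] is now only the second smallest: a window that contains both
    [a] and [m] is an occurrence exactly when it is [a x m] with [u = [:: x]],
    because [a < m < x]. *)
Lemma avoid132_seq_cons_cat_min (a m : nat) (u v : seq nat) :
  a < m -> all (ltn m) u -> all (ltn m) v ->
  avoid132_seq (a :: u ++ m :: v) =
    [&& avoid132_seq (a :: u), size u != 1 & avoid132_seq (m :: v)].
Proof.
move=> ltam ltmu ltmv.
case: u ltmu => [|x [|y u]] ltmu.
- case: v ltmv => [|c v] //= /andP[ltmc _].
  by rewrite (ltnNge c m) (ltnW ltmc) andbF.
- by move: ltmu; rewrite /= andbT ltam => ->.
- have := avoid132_seq_cat_min v ltmu.
  by rewrite /= => ->; rewrite !andbA.
Qed.

(** * Words starting with their minimum *)

Lemma perm_permutations_map (T1 T2 : eqType) (h : T1 -> T2) (s : seq T1) :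
  uniq s -> {in s &, injective h} ->
  perm_eq (permutations (map h s)) (map (map h) (permutations s)).
Proof.
move=> uniq_s inj_h.
have uniq_hp : uniq (map (map h) (permutations s)).
  rewrite map_inj_in_uniq ?permutations_uniq // => u v.
  rewrite !mem_permutations => pu pv.
  by apply: (inj_in_map inj_h); rewrite inE; apply/allP => x;
     rewrite ?(perm_mem pu) ?(perm_mem pv).
have [||_ eq_mem] := uniq_min_size (s2 := permutations (map h s)) uniq_hp.
- move=> w0 /mapP[w]; rewrite !mem_permutations => pw ->; exact: perm_map.
- by rewrite size_map !size_permutations ?map_inj_in_uniq // size_map.
by apply: uniq_perm => //; exact: permutations_uniq.
Qed.

(** For a list [s] of positive letters, [0 :: w] is a word that starts with its
    minimum; this is how a circular permutation is cut open. *)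
Definition count_min_first (s : seq nat) : nat :=
  count (fun w => avoid132_seq (0 :: w)) (permutations s).

(** Only the relative order of the letters matters: relabel by the increasing
    bijection from [0, ..., size s] to [0 :: s]. *)
Lemma count_min_first_iota (s : seq nat) :
  sorted ltn s -> all (ltn 0) s ->
  count_min_first s = count_min_first (iota 1 (size s)).
Proof.
move=> sort_s pos_s.
pose h := nth 0 (0 :: s).
have hs : map h (iota 1 (size s)) = s.
  by rewrite (iotaDl 1 0) -map_comp map_nth_iota0 // take_size.
have sort0s : sorted ltn (0 :: s) by rewrite /= path_min_sorted.
have mono_h : {in 0 :: iota 1 (size s) &, {mono h : x y / x < y}}.
  move=> x y; rewrite -[_ :: iota _ _]/(iota 0 (size (0 :: s))).
  rewrite !mem_iota /= !add0n => ltx lty.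
  rewrite /h; case: (ltngtP x y) => [ltxy|ltyx|->]; last by rewrite ltnn.
    by apply: (sorted_ltn_nth ltn_trans).
  apply/negbTE; rewrite -leqNgt ltnW //.
  by apply: (sorted_ltn_nth ltn_trans).
have inj_h : {in iota 1 (size s) &, injective h}.
  move=> x y xi yi eqh; case: (ltngtP x y) => // [lt_xy|lt_yx].
    by rewrite -mono_h ?inE ?xi ?yi ?orbT // eqh ltnn in lt_xy.
  by rewrite -mono_h ?inE ?xi ?yi ?orbT // eqh ltnn in lt_yx.
rewrite /count_min_first -{1}hs.
rewrite (seq.permP (perm_permutations_map (iota_uniq _ _) inj_h)) count_map.
apply: eq_in_count => w; rewrite mem_permutations => pw.
apply: (@avoid132_seq_map h (0 :: w)).
by apply: sub_in2 mono_h => x; rewrite !inE (perm_mem pw).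
Qed.

Lemma avoid132_seq_cons_min (a m : nat) (v : seq nat) :
  all (ltn a) v -> all (ltn m) v ->
  avoid132_seq (a :: v) = avoid132_seq (m :: v).
Proof. by case: v => [|c [|d v]] //= /and3P[_ -> _] /and3P[_ -> _]. Qed.

Lemma sum_subsets_card (n : nat) (F : nat -> nat) :
  \sum_(B : {set 'I_n}) F #|B| = \sum_(k < n.+1) 'C(n, k) * F k.
Proof.
have ltB (B : {set 'I_n}) : #|B| < n.+1.
  by rewrite ltnS -[leqRHS]card_ord max_card.
rewrite (partition_big (fun B : {set 'I_n} => Ordinal (ltB B)) predT) //=.
apply: eq_bigr => k _.
have -> : 'C(n, k) = #|[set B : {set 'I_n} | #|B| == k]|.
  by rewrite card_draws card_ord.
rewrite -sum_nat_const.
by apply: eq_big => [B|B /eqP <-] //; rewrite inE.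
Qed.

(** * Splitting a word at its minimum *)

(** The letters 2, ..., n + 1, that is, those of [iota 1 n.+1] above its
    minimum, are indexed by ['I_n], so that [B] ranges over all choices of the
    letters to the left of the minimum. *)
Definition upper_entries (n : nat) (B : {set 'I_n}) : seq nat :=
  [seq i.+2 | i : 'I_n <- enum B].

Definition min_splits (n : nat) : seq (seq nat) :=
  flatten [seq [seq u ++ 1 :: v | u <- permutations (upper_entries B),
                                 v <- permutations (upper_entries (~: B))]
          | B : {set 'I_n}].

Lemma mem_upper_entries (n : nat) (B : {set 'I_n}) (x : nat) :
  x \in upper_entries B -> 1 < x.
Proof. by case/mapP => i _ ->. Qed.

Lemma size_upper_entries (n : nat) (B : {set 'I_n}) :
  size (upper_entries B) = #|B|.
Proof. by rewrite size_map -cardE. Qed.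

Lemma size_upper_entriesC (n : nat) (B : {set 'I_n}) :
  size (upper_entries (~: B)) = n - #|B|.
Proof. by rewrite size_upper_entries cardsCs finset.setCK card_ord. Qed.

Lemma upper_entries_uniq (n : nat) (B : {set 'I_n}) : uniq (upper_entries B).
Proof. by rewrite map_inj_uniq ?enum_uniq // => i j [/val_inj]. Qed.

Lemma upper_entries_sorted (n : nat) (B : {set 'I_n}) :
  sorted ltn (upper_entries B).
Proof.
rewrite sorted_map (@eq_sorted _ _ (relpre val ltn)) // -sorted_map.
apply: (subseq_sorted ltn_trans _ (iota_ltn_sorted 0 n)).
by rewrite -val_enum_ord map_subseq // enumT; apply: filter_subseq.
Qed.

Lemma perm_min_splits (n : nat) :
  perm_eq (permutations (iota 1 n.+1)) (min_splits n).
Proof.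
have sub : {subset permutations (iota 1 n.+1) <= min_splits n}.
  move=> w; rewrite mem_permutations => pw.
  have uw : uniq w by rewrite (perm_uniq pw) iota_uniq.
  have mw : 1 \in w by rewrite (perm_mem pw) inE eqxx.
  move: mw uw pw; case/splitPr => u v uw pw.
  have puv : perm_eq (u ++ v) (iota 2 n).
    by move: pw; rewrite perm_catC cat_cons perm_cons perm_catC.
  have memB (t : seq nat) : uniq t -> {subset t <= iota 2 n} ->
    perm_eq t (upper_entries [set i : 'I_n | (i : nat).+2 \in t]).
    move=> ut st; apply: uniq_perm => //; first exact: upper_entries_uniq.
    move=> x; apply/idP/mapP => [xt|[i]]; last by rewrite mem_enum inE => ? ->.
    have := st _ xt; rewrite mem_iota; case: x xt => [|[|x]] // xt ltx.
    by exists (Ordinal (ltx : x < n)); rewrite // mem_enum inE.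
  have [uu uv] : uniq u /\ uniq v.
    by move: uw; rewrite cat_uniq /= => /and4P[? _ _ ?].
  have su : {subset u <= iota 2 n}.
    by move=> x xu; rewrite -(perm_mem puv) mem_cat xu.
  have sv : {subset v <= iota 2 n}.
    by move=> x xv; rewrite -(perm_mem puv) mem_cat xv orbT.
  apply/flattenP; set B := [set i : 'I_n | (i : nat).+2 \in u].
  eexists; first exact: (@fintype.image_f _ _ _ predT B isT).
  apply/allpairsP; exists (u, v); split=> //=; rewrite mem_permutations.
    exact: memB.
  suff ->: ~: B = [set i : 'I_n | (i : nat).+2 \in v] by apply: memB.
  apply/setP => i; rewrite !inE.
  have := perm_mem puv i.+2; rewrite mem_cat mem_iota add2n !ltnS ltn_ord /=.
  have := uw; rewrite cat_uniq /= negb_or => /and3P[_ /andP[_ /hasPn nv] _].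
  case: (boolP (_ \in v)) => [/nv -> //|_]; by rewrite orbF => ->.
(* [sub] is an equality, and [min_splits n] has no repetitions, because both
   lists have (n + 1)! elements: there are n + 1 sizes k for [B], and each
   contributes binomial(n, k) k! (n - k)! = n!. *)
have size_eq : size (min_splits n) <= size (permutations (iota 1 n.+1)).
  rewrite size_permutations ?iota_uniq // size_iota.
  rewrite size_flatten /shape -map_comp sumnE big_map big_enum /=.
  rewrite (eq_bigr (fun B : {set 'I_n} => (#|B|)`! * (n - #|B|)`!)).
    rewrite (sum_subsets_card n (fun k => k`! * (n - k)`!)).
    rewrite (eq_bigr (fun=> n`!)) => [|k _]; last by rewrite bin_fact // -ltnS.
    by rewrite sum_nat_const card_ord factS.
  move=> B _; rewrite /= size_allpairs.
  rewrite !size_permutations ?upper_entries_uniq //.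
  by rewrite size_upper_entries size_upper_entriesC.
have uperm := permutations_uniq (iota 1 n.+1).
have [_ eq_mem] := uniq_min_size uperm sub size_eq.
apply: uniq_perm => //; exact: leq_size_uniq uperm sub size_eq.
Qed.

Arguments avoid132_seq : simpl never.

Definition num_min_first (n : nat) : nat := count_min_first (iota 1 n).

(** Split each word at its minimum, and group the splittings by the number [k]
    of letters on the left. *)
Lemma num_min_first_rec (n : nat) :
  num_min_first n.+1 =
  \sum_(k < n.+1) 'C(n, k) *
     ((k != 1 :> nat) * num_min_first k * num_min_first (n - k)).
Proof.
rewrite -(sum_subsets_card n
  (fun k => (k != 1) * num_min_first k * num_min_first (n - k))).
have cntE (p : pred (seq nat)) s : count p s = \sum_(w <- s) p w.
  by rewrite -sum1_count big_mkcond.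
have cmfE (B : {set 'I_n}) : num_min_first #|B| =
    \sum_(w <- permutations (upper_entries B)) avoid132_seq (0 :: w).
  rewrite -cntE /num_min_first -size_upper_entries -count_min_first_iota //.
    exact: upper_entries_sorted.
  by apply/allP => x /mem_upper_entries/ltnW.
rewrite {1}/num_min_first /count_min_first (seq.permP (perm_min_splits n)) cntE.
rewrite big_flatten /= big_map big_enum /=; apply: eq_bigr => B _.
have -> : n - #|B| = #|~: B| by rewrite -size_upper_entriesC size_upper_entries.
rewrite !cmfE big_allpairs_dep -mulnA big_distrlr big_distrr /=.
apply: eq_big_seq => u; rewrite mem_permutations => pu.
rewrite big_distrr /=; apply: eq_big_seq => v; rewrite mem_permutations => pv.
have min_u : all (ltn 1) u.
  by apply/allP => x; rewrite (perm_mem pu) => /mem_upper_entries.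
have min_v : all (ltn 1) v.
  by apply/allP => x; rewrite (perm_mem pv) => /mem_upper_entries.
rewrite (@avoid132_seq_cons_cat_min 0 1 u v) //.
rewrite (perm_size pu) size_upper_entries.
rewrite (@avoid132_seq_cons_min 1 0 v) //; last first.
  by apply: sub_all min_v => x /ltnW.
by rewrite andbCA -!mulnb.
Qed.

(** * Cutting a circular permutation at its minimum *)

Local Open Scope ring_scope.

Lemma val_shift_permX (n : nat) (k : nat) (i : 'I_n) :
  (shift_perm n ^+ k)%g i = ((i + k) %% n)%N :> nat.
Proof.
elim: k => [|k IHk]; first by rewrite expg0 perm1 addn0 modn_small.
by rewrite expgSr permM permE /= IHk addnS -addn1 modnDml addn1.
Qed.

Lemma circP (n : nat) (s t : 'S_n) :
  reflect (exists k, t = (shift_perm n ^+ k * s)%g) (t \in circ s).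
Proof.
apply: (iffP idP) => [/rcosetP[_ /cycleP[k ->] ->]|[k ->]]; first by exists k.
by apply/rcosetP; exists (shift_perm n ^+ k)%g; rewrite ?mem_cycle.
Qed.

Lemma circ_min_first_inj (n : nat) (s t : 'S_n.+1) :
  s ord0 = ord0 -> t ord0 = ord0 -> circ s = circ t -> s = t.
Proof.
move=> s0 t0 eq_st.
have /circP[k sE] : s \in circ t by rewrite -eq_st rcoset_refl.
have /perm_inj/(congr1 val) : t ((shift_perm n.+1 ^+ k)%g ord0) = t ord0.
  by rewrite t0 -permM -sE.
rewrite /= val_shift_permX add0n => modk.
rewrite sE; suff ->: (shift_perm n.+1 ^+ k)%g = 1%g by rewrite mul1g.
apply/permP => i; apply: val_inj; rewrite perm1 /= val_shift_permX.
by rewrite -modnDmr modk addn0 modn_small.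
Qed.

Lemma circ_min_first_ex (n : nat) (s : 'S_n.+1) :
  exists2 t : 'S_n.+1, t ord0 = ord0 & circ s = circ t.
Proof.
(* rotate by the position [k] of the minimum *)
pose k : nat := (s^-1)%g ord0.
exists (shift_perm n.+1 ^+ k * s)%g.
  rewrite permM.
  suff ->: (shift_perm n.+1 ^+ k)%g ord0 = (s^-1)%g ord0 by rewrite permKV.
  by apply: val_inj; rewrite /= val_shift_permX add0n modn_small /k.
by apply/esym/rcoset_eqP/circP; exists k.
Qed.

Lemma has132P (n : nat) (s : 'S_n) :
  reflect (exists i j k : 'I_n,
     [/\ j = i.+1 :> nat, k = i.+2 :> nat & (s i < s k < s j)%N]) (has132 s).
Proof.
apply: (iffP existsP) => -[i].
  by move=> /existsP[j] /existsP[k] /and3P[/eqP ? /eqP ? ?]; exists i, j, k.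
move=> [j [k [ji ki lts]]]; exists i.
apply/existsP; exists j; apply/existsP; exists k.
by rewrite ji ki lts !eqxx.
Qed.

(** An occurrence in a rotation of [s] consists of cyclically consecutive
    entries of [s]; the last two exceed the first, so neither of them is the
    minimum, which stands at position 0, and the occurrence does not wrap around. *)
Lemma avoids132_circ (n : nat) (s : 'S_n.+1) :
  s ord0 = ord0 -> avoids132 (circ s) = ~~ has132 s.
Proof.
move=> s0; apply/forall_inP/idP => [|avoid_s t /circP[r tE]].
  by apply; apply: rcoset_refl.
apply: contra avoid_s => /has132P[i [j [k [ji ki lts]]]].
pose rot (x : 'I_n.+1) := (shift_perm n.+1 ^+ r)%g x.
have tsE x : t x = s (rot x) by rewrite tE permM.
have rotE x : rot x = ((x + r) %% n.+1)%N :> nat by exact: val_shift_permX.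
have rot_succ (x y : 'I_n.+1) : y = x.+1 :> nat -> (0 < s (rot y))%N ->
    rot y = (rot x).+1 :> nat.
  move=> yx s_pos; rewrite !rotE yx addSn -addn1 -modnDml addn1 modn_small //.
  rewrite ltn_neqAle ltn_mod andbT; apply/eqP => rx.
  have rot0 : rot y = ord0.
    apply: val_inj; rewrite [LHS]rotE yx.
    by rewrite addSn -addn1 -modnDml addn1 rx modnn.
  by rewrite rot0 s0 in s_pos.
move: lts; rewrite !tsE => lts; have /andP[lt_ik lt_kj] := lts.
have rj := rot_succ i j ji (leq_ltn_trans (leq0n _) lt_kj).
have rk : rot k = (rot j).+1 :> nat.
  by apply: rot_succ; [rewrite ki ji | exact: leq_ltn_trans lt_ik].
by apply/has132P; exists (rot i), (rot j), (rot k); split; rewrite // rk rj.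
Qed.

Lemma num_avoid132_min_first (n : nat) :
  num_avoid132 n.+1 = #|[set s : 'S_n.+1 | (s ord0 == ord0) && ~~ has132 s]|.
Proof.
rewrite /num_avoid132 -(@card_in_imset _ _ (@circ n.+1)).
  apply: eq_card => c; rewrite !inE.
  apply/andP/imsetP => [[/imsetP[s _ ->]]|[s]].
    have [t t0 ->] := circ_min_first_ex s.
    by rewrite avoids132_circ // => avoid_t; exists t; rewrite // inE t0 eqxx.
  rewrite inE => /andP[/eqP s0 avoid_s] ->.
  by rewrite avoids132_circ // avoid_s imset_f.
move=> s t; rewrite !inE => /andP[/eqP s0 _] /andP[/eqP t0 _].
exact: circ_min_first_inj.
Qed.

(** * Permutations as words *)

Definition one_line (n : nat) (s : 'S_n) : seq nat :=
  [seq val (s i) | i <- enum 'I_n].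

Lemma nth_one_line (n : nat) (s : 'S_n) (i : 'I_n) : nth 0 (one_line s) i = s i.
Proof. by rewrite (nth_map i) ?size_enum_ord // nth_ord_enum. Qed.

Lemma size_one_line (n : nat) (s : 'S_n) : size (one_line s) = n.
Proof. by rewrite size_map size_enum_ord. Qed.

Lemma one_line_inj (n : nat) : injective (@one_line n).
Proof.
move=> s t eq_st; apply/permP => i; apply: val_inj.
by rewrite /= -!nth_one_line eq_st.
Qed.

Lemma perm_one_line (n : nat) (s : 'S_n) : perm_eq (one_line s) (iota 0 n).
Proof.
rewrite -val_enum_ord /one_line map_comp; apply: perm_map.
apply: uniq_perm; first by rewrite (map_inj_uniq (@perm_inj _ s)) enum_uniq.
  exact: enum_uniq.
move=> i; rewrite mem_enum; apply/mapP; exists ((s^-1)%g i).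
  by rewrite mem_enum.
by rewrite permKV.
Qed.

Lemma one_line_ex (n : nat) (w : seq nat) :
  perm_eq w (iota 0 n) -> exists s : 'S_n, one_line s = w.
Proof.
move=> pw.
have size_w : size w = n by rewrite (perm_size pw) size_iota.
have w_lt (i : 'I_n) : (nth 0 w i < n)%N.
  have : nth 0 w i \in w by rewrite mem_nth ?size_w.
  by rewrite (perm_mem pw) mem_iota.
have inj_w : injective (fun i => Ordinal (w_lt i)).
  move=> i j [] /eqP; rewrite nth_uniq ?size_w ?(perm_uniq pw) ?iota_uniq //.
  by move=> /eqP/val_inj.
exists (perm inj_w); apply: (@eq_from_nth _ 0%N).
  by rewrite size_one_line.
move=> i; rewrite size_one_line => lt_in.
by rewrite -[i]/(val (Ordinal lt_in)) nth_one_line permE.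
Qed.

Lemma avoid132_one_line (n : nat) (s : 'S_n) :
  avoid132_seq (one_line s) = ~~ has132 s.
Proof.
apply/avoid132_seqP/negP => [avoid_s /has132P[i [j [k [ji ki lts]]]]|avoid_s i].
  have := avoid_s i; rewrite size_one_line -ki -ji !nth_one_line lts.
  by move=> /(_ (ltn_ord k)).
rewrite size_one_line => lt2; apply/negP => lts; apply: avoid_s.
have lt1 := ltnW lt2; have lt0 := ltnW lt1.
apply/has132P; exists (Ordinal lt0), (Ordinal lt1), (Ordinal lt2); split=> //.
by rewrite -!nth_one_line.
Qed.

(** The word of a permutation that sends 0 to 0 has the form [0 :: u]. *)
Lemma num_avoid132S (n : nat) : num_avoid132 n.+1 = num_min_first n.
Proof.
rewrite num_avoid132_min_first /num_min_first /count_min_first -size_filter.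
rewrite cardE -(size_map (@one_line n.+1)).
rewrite -[in RHS](size_map (cons 0)); apply/perm_size/uniq_perm.
- by rewrite (map_inj_uniq (@one_line_inj _)) enum_uniq.
- by rewrite map_inj_uniq ?filter_uniq ?permutations_uniq // => u v [].
have head_one_line (s : 'S_n.+1) : head 0 (one_line s) = s ord0.
  by rewrite -nth0 -nth_one_line.
move=> w; apply/mapP/mapP => -[].
  move=> s; rewrite mem_enum inE => /andP[/eqP s0 avoid_s] ->.
  have := head_one_line s; have := avoid132_one_line s; have := perm_one_line s.
  rewrite s0; case: (one_line s) => [|x u] pu au //= x0.
  move: pu au; rewrite x0 /= perm_cons => pu au.
  by exists u; rewrite // mem_filter au avoid_s mem_permutations.
move=> u; rewrite mem_filter mem_permutations => /andP[avoid_u pu] ->.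
have /one_line_ex[s sE] : perm_eq (0 :: u) (iota 0 n.+1).
  by rewrite /= perm_cons.
exists s; rewrite ?sE // mem_enum inE -avoid132_one_line sE avoid_u andbT.
by apply/eqP/val_inj; rewrite /= -head_one_line sE.
Qed.

Lemma num_avoid132_0 : num_avoid132 0 = 1.
Proof.
apply/eqP/cards1P; exists (circ 1%g); apply/setP => c; rewrite !inE.
have S0 (s : 'S_0) : s = 1%g by apply/permP => -[].
apply/andP/eqP => [[/imsetP[s _ ->] _]|->]; first by rewrite (S0 s).
split; first exact: imset_f.
by apply/forall_inP => s _; apply/has132P => -[[]].
Qed.

(** * Exponentials of power series *)

(** The first [N] coefficients of a power are those of the power of the
    truncated polynomial, which gives access to the algebra of [{poly R}]. *)
Lemma coef_fps_pow (R : realType) (F : nat -> R) (N k n : nat) :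
  (n < N)%N -> fps_pow F k n = ((\poly_(i < N) F i) ^+ k)`_n.
Proof.
elim: k n => [|k IHk] n ltnN; first by rewrite expr0 coef1.
rewrite exprS coefM [LHS]/=; apply: eq_bigr => i _.
rewrite coef_poly (leq_ltn_trans (ltn_ord i : (i <= n)%N) ltnN) -IHk //.
exact: leq_ltn_trans (leq_subr _ _) ltnN.
Qed.

Lemma fps_pow_eq0 (R : realType) (F : nat -> R) (k n : nat) :
  F 0%N = 0 -> (n < k)%N -> fps_pow F k n = 0.
Proof.
move=> F0; elim: k n => [|k IHk] // n ltnk.
rewrite [LHS]/= /fps_mul big1 // => -[[|i] /= lti] _; first by rewrite F0 mul0r.
rewrite [X in _ * X]IHk ?mulr0 // (leq_trans _ (ltnk : (n <= k)%N)) //.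
by rewrite ltn_subrL /= (leq_ltn_trans (leq0n i)).
Qed.

(** Without constant term, F^k starts in degree k, so that the series defining a
    coefficient of the exponential is a finite sum. *)
Lemma fps_expE (R : realType) (F : nat -> R) (N n : nat) :
  F 0%N = 0 -> (n < N)%N ->
  fps_exp F n = \sum_(k < N) fps_pow F k n / k`!%:R.
Proof.
move=> F0 ltnN; rewrite /fps_exp; apply: lim_near_cst.
  exact: norm_hausdorff.
exists N => // M /= leNM; rewrite /series /=.
rewrite -(big_mkord predT (fun k => fps_pow F k n / k`!%:R)).
rewrite (big_cat_nat (n := N)) //= [X in _ + X]big1_seq ?addr0 // => k.
rewrite mem_index_iota => /andP[_ /andP[leNk _]].
by rewrite fps_pow_eq0 ?mul0r // (leq_trans ltnN).
Qed.

Lemma pseries_diffs_pow (R : realType) (F : nat -> R) (k n : nat) :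
  pseries_diffs (fps_pow F k.+1) n =
  k.+1%:R * fps_mul (pseries_diffs F) (fps_pow F k) n.
Proof.
rewrite /pseries_diffs (@coef_fps_pow _ _ n.+2) // mulr_natl -coef_deriv.
rewrite deriv_exp /= coefMn [RHS]mulr_natl; congr (_ *+ _).
rewrite coefM; apply: eq_bigr => i _.
have lti := ltn_ord i.
rewrite coef_deriv coef_poly ltnS ltn_ord mulr_natl (@coef_fps_pow _ _ n.+2) //.
by rewrite ltnS (leq_trans (leq_subr _ _)).
Qed.

(** Termwise, the derivative of F^k/k! is F' F^(k-1)/(k-1)!. *)
Lemma pseries_diffs_exp (R : realType) (F : nat -> R) (n : nat) :
  F 0%N = 0 ->
  pseries_diffs (fps_exp F) n = fps_mul (pseries_diffs F) (fps_exp F) n.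
Proof.
move=> F0; rewrite {1}/pseries_diffs (@fps_expE _ _ n.+2) //.
rewrite big_ord_recl /= /fps_monomial mul0r add0r big_distrr /=.
transitivity (\sum_(k < n.+1)
    \sum_(i < n.+1) pseries_diffs F i * (fps_pow F k (n - i)%N / k`!%:R)).
  apply: eq_bigr => k _; rewrite /bump /= add1n mulrA.
  rewrite -[_ * fps_mul _ _ _]/(pseries_diffs (fps_pow F k.+1) n).
  rewrite pseries_diffs_pow.
  rewrite factS natrM invfM mulrACA divff ?pnatr_eq0 // mul1r mulr_suml.
  by apply: eq_bigr => i _; rewrite mulrA.
rewrite exchange_big; apply: eq_bigr => i _.
rewrite (@fps_expE _ _ n.+1) ?big_distrr // ltnS leq_subr //.
Qed.

Lemma fps_exp0 (R : realType) (F : nat -> R) : F 0%N = 0 -> fps_exp F 0%N = 1.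
Proof.
by move=> F0; rewrite (@fps_expE _ _ 1) // big_ord1 /= fact0 divr1.
Qed.

(** The differential equation determines the coefficient of degree n + 1 from
    those of degree at most n. *)
Lemma fps_exp_unique (R : realType) (F G : nat -> R) :
  F 0%N = 0 -> G 0%N = 1 ->
  (forall n, pseries_diffs G n = fps_mul (pseries_diffs F) G n) ->
  G = fps_exp F.
Proof.
move=> F0 G0 dG; apply/funext => n.
elim/ltn_ind: n => -[|n] IHn; first by rewrite G0 fps_exp0.
apply: (@mulfI _ n.+1%:R); first by rewrite pnatr_eq0.
rewrite -[LHS]/(pseries_diffs G n) -[RHS]/(pseries_diffs (fps_exp F) n).
rewrite dG pseries_diffs_exp //; apply: eq_bigr => i _.
by rewrite IHn // ltnS leq_subr.
Qed.

(** * The differential equation *)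

Lemma pseries_diffs_C132 (R : realType) (n : nat) :
  pseries_diffs (C132 R) n = (num_min_first n)%:R / n`!%:R.
Proof.
rewrite /pseries_diffs /C132 num_avoid132S factS natrM invfM mulrCA mulrA.
by rewrite -mulrA mulVKf ?pnatr_eq0.
Qed.

Theorem mainTheorem3 (R : realType) :
  pseries_diffs (C132 R) =
  fps_exp (fun n : nat =>
    C132 R n - fps_monomial R 0 n - fps_monomial R 2 n / 2).
Proof.
set E := (fun n : nat => _).
have dE n : pseries_diffs E n =
    ((n != 1)%N * num_min_first n)%:R / n`!%:R.
  have -> : pseries_diffs E n =
      pseries_diffs (C132 R) n - n.+1%:R * (fps_monomial R 2 n.+1 / 2).
    by rewrite /pseries_diffs /E {2}/fps_monomial /= subr0 mulrBr.
  rewrite pseries_diffs_C132 /fps_monomial eqSS.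
  case: eqP => [->|_]; last by rewrite mul0r mulr0 subr0 mul1n.
  (* b_1 = 1 *)
  by rewrite /= !mul1r divff ?pnatr_eq0 // invr1 subrr mul0n mul0r.
apply: fps_exp_unique.
- rewrite /E /C132 /fps_monomial num_avoid132_0 /=.
  by rewrite fact0 divr1 subrr mul0r subr0.
- by rewrite pseries_diffs_C132 fact0 divr1.
move=> n; rewrite {1}/pseries_diffs pseries_diffs_C132.
rewrite factS natrM invfM mulrCA mulVKf ?pnatr_eq0 // num_min_first_rec.
rewrite natr_sum mulr_suml; apply: eq_bigr => k _.
rewrite dE pseries_diffs_C132 !natrM mulrACA -invfM -natrM.
have lekn : (k <= n)%N by rewrite -ltnS.
rewrite -(bin_fact lekn) !natrM.
rewrite -mulf_div divff ?mul1r //.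
by rewrite pnatr_eq0 -lt0n bin_gt0.
Qed.
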